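(* Every (finite, simple) graph $G$ has a secure coalition partition.
   Context: Graphs are finite and simple with a non-empty vertex set; $n=|V(G)|$ is the order of $G$. A set $D\subseteq V(G)$ is a dominating set if every vertex of $V(G)\setminus D$ is adjacent to at least one vertex of $D$. A secure dominating set $S$ of $G$ is a dominating set such that each vertex $u\in V(G)\setminus S$ is adjacent to some vertex $v\in S$ for which $(S\setminus\{v\})\cup\{u\}$ is a dominating set. Two disjoint vertex sets $V_1,V_2\subseteq V(G)$ form a secure coalition if neither $V_1$ nor $V_2$ is a secure dominating set but $V_1\cup V_2$ is a secure dominating set. A secure coalition partition ($sec$-partition) of $G$ is a partition $\pi=\{V_1,\dots,V_k\}$ of $V(G)$ (into non-empty sets) such that every $V_i$ either is a secure dominating set consisting of a single vertex of degree $n-1$, or is not a secure dominating set but forms a secure coalition with another set $V_j\in\pi$. *)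

(* Defs.v *)
From mathcomp Require Import all_boot.

Set Implicit Arguments.
Unset Strict Implicit.
Unset Printing Implicit Defensive.

(* A graph on the finite vertex type T is an adjacency relation e : rel T that
   is symmetric and irreflexive; the definitions below take any relation. *)

Definition degree (T : finType) (e : rel T) (v : T) : nat :=
  #|[set u | e v u]|.

Definition dominating (T : finType) (e : rel T) (D : {set T}) : bool :=
  [forall u, (u \notin D) ==> [exists v in D, e u v]].

Definition secure_dominating (T : finType) (e : rel T) (S : {set T}) : bool :=
  dominating e S &&
  [forall u, (u \notin S) ==>
     [exists v in S, e u v && dominating e ((S :\ v) :|: [set u])]].

Definition secure_coalition (T : finType) (e : rel T) (A B : {set T}) : bool :=
  [&& [disjoint A & B],
      ~~ secure_dominating e A,
      ~~ secure_dominating e B &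
      secure_dominating e (A :|: B)].

(* Finset partitions have no empty block. *)
Definition sec_partition (T : finType) (e : rel T) (P : {set {set T}}) : Prop :=
  partition P [set: T] /\
  forall A : {set T}, A \in P ->
    (secure_dominating e A /\
       exists v : T, A = [set v] /\ degree e v = #|T| - 1) \/
    (~~ secure_dominating e A /\
       exists B : {set T}, [/\ B \in P, B != A & secure_coalition e A B]).

(* Main.v *)
Require Import Defs.
From mathcomp Require Import all_boot.

(** A superset of a secure dominating set is again one, so the secure dominating
sets form an upward closed family containing the whole vertex set, and very
little more about graphs is used.

If the graph is complete, any single vertex dominates it, so every singleton is a
secure dominating set of a vertex of full degree, and the partition into
singletons works.  If the graph is not complete, no secure
dominating set has fewer than two elements ([small_secure_dominating]): a single
vertex could only be defended by being swapped with each other vertex in turn,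
so every vertex would have to dominate the graph.

The second case is a statement about any upward closed family whose members all
have at least two elements ([allied_partition_exists]): each member [U] can be
partitioned into non-members, each of which has a partner making their union a
member.  Take a minimal member [D] inside [U] and split it into two non-empty
parts [A] and [B]; by minimality these are non-members that are allied.  It
remains to place the rest [R] of [U].  If [R] is a member, it is partitioned by
induction; if it is a non-member allied with [A] or with [B], it is a block of
its own; and if it is allied with neither, then the union of [B] and [R] is a
non-member, still allied with [A]. *)

(** * Allied partitions for an upward closed family *)

Section Allies.

Set Implicit Arguments.
Unset Strict Implicit.

Variables (T : finType) (F : pred {set T}).
Implicit Types (A B C U : {set T}) (P : {set {set T}}).

(** Disjointness is left out because it is automatic for distinct blocks of a
partition; distinctness itself follows from idempotence of union. *)
Definition allied A B := [&& ~~ F A, ~~ F B & F (A :|: B)].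

Definition all_allied P := forall A, A \in P -> exists2 B, B \in P & allied A B.

Lemma disjoint_setUr A B C :
  [disjoint A & B] -> [disjoint A & C] -> [disjoint A & B :|: C].
Proof. by rewrite -!setI_eq0 setIUr setU_eq0 => -> ->. Qed.

Lemma alliedC A B : allied A B = allied B A.
Proof. by rewrite /allied setUC andbCA. Qed.

Lemma allied_neq A B : allied A B -> B != A.
Proof.
by case/and3P=> nFA _; apply: contraTneq => ->; rewrite setUid.
Qed.

Lemma all_alliedU1 P A B :
  all_allied P -> B \in P -> allied A B -> all_allied (A |: P).
Proof.
move=> allP PB AB C /setU1P[-> | /allP[E PE CE]].
  by exists B => //; apply: setU1r.
by exists E => //; apply: setU1r.
Qed.

Lemma all_alliedU2 P A B :
  all_allied P -> allied A B -> all_allied (A |: (B |: P)).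
Proof.
move=> allP AB C; rewrite !in_setU1.
case/or3P=> [/eqP-> | /eqP-> | /allP[E PE CE]].
- by exists B => //; rewrite !inE eqxx orbT.
- by exists A; rewrite 1?alliedC // !inE eqxx.
- by exists E => //; rewrite !inE PE !orbT.
Qed.

Lemma partitionU2 P U A B :
    partition P U -> A != set0 -> B != set0 -> [disjoint A & B] ->
    [disjoint A & U] -> [disjoint B & U] ->
  partition (A |: (B |: P)) (A :|: (B :|: U)).
Proof.
move=> partP A0 B0 dAB dAU dBU; apply: partitionU1 => //.
  exact: partitionU1.
exact: disjoint_setUr.
Qed.

Lemma partition_pair A B :
    A != set0 -> B != set0 -> [disjoint A & B] ->
  partition [set A; B] (A :|: B).
Proof.
move=> A0 B0 dAB.
have part0 : partition (set0 : {set {set T}}) set0 by rewrite partition_set0.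
by have := partitionU2 part0 A0 B0 dAB; rewrite !setU0 -!setI_eq0 !setI0 eqxx; apply.
Qed.

Lemma all_allied_pair A B : allied A B -> all_allied [set A; B].
Proof.
move=> AB; rewrite -[[set B]]setU0; apply: all_alliedU2 => // C.
by rewrite inE.
Qed.

Hypothesis F_up : forall A B, A \subset B -> F A -> F B.
Hypothesis F_gt1 : forall A, F A -> 1 < #|A|.

(** Any proper splitting of a minimal member would do; one part is taken to be a
singleton. *)
Lemma member_contains_allies U :
  F U -> exists A B, [/\ A :|: B \subset U, A != set0, B != set0,
                         [disjoint A & B] & allied A B].
Proof.
case/minset_exists=> D /minsetP[FD minD] sDU.
have /card_gt0P[x Dx] : 0 < #|D| by apply: ltnW; apply: F_gt1.
have DE : [set x] :|: (D :\ x) = D by apply: setD1K.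
exists [set x], (D :\ x); split.
- by rewrite DE.
- by apply/set0Pn; exists x; rewrite set11.
- by rewrite -card_gt0; have := F_gt1 FD; rewrite (cardsD1 x D) Dx.
- by rewrite disjoints1 setD11.
- rewrite /allied DE FD andbT; apply/andP; split.
    by apply/negP=> /F_gt1; rewrite cards1.
  apply/negP=> FDx; have := minD _ FDx (subD1set D x) => eDx.
  by move: Dx; rewrite -eDx !inE eqxx.
Qed.

(** The empty set is admitted beside the members so that an empty remainder is
absorbed by the inductive case. *)
Lemma allied_partition_exists U :
  F U || (U == set0) -> exists2 P, partition P U & all_allied P.
Proof.
have [n] := ubnP #|U|; elim: n U => // n IHn U leUn.
have [-> _ | nzU] := eqVneq U set0.
  by exists set0; [rewrite partition_set0 | move=> A; rewrite inE].
rewrite orbF => /member_contains_allies[A [B [sABU A0 B0 dAB alAB]]].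
pose R := U :\: (A :|: B).
have UE : (A :|: B) :|: R = U.
  by rewrite -{1}(setIidPr sABU) setID.
have [dAR dBR] : [disjoint A & R] /\ [disjoint B & R].
  have dABR : [disjoint A :|: B & R].
    by have := subxx R; rewrite {2}/R subsetD disjoint_sym => /andP[].
  by split; apply: disjointWl dABR; rewrite ?subsetUl ?subsetUr.
have ltRU : #|R| < #|U|.
  rewrite -(cardsID (A :|: B) U) (setIidPr sABU) -[ltnLHS]add0n ltn_add2r card_gt0.
  by rewrite setU_eq0 (negPf A0).
have [FR0 | ] := boolP (F R || (R == set0)).
  have [P partP allP] := IHn R (leq_trans ltRU leUn) FR0.
  exists (A |: (B |: P)); last exact: all_alliedU2.
  by rewrite -UE -setUA; apply: partitionU2.
case/norP=> nFR R0; have [nFA nFB FAB] := and3P alAB.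
have partR : partition (R |: [set A; B]) U.
  rewrite -UE [X in partition _ X]setUC; apply: partitionU1 => //;
    first exact: partition_pair.
  by apply: disjoint_setUr; rewrite disjoint_sym.
have [FRA | nFRA] := boolP (F (R :|: A)).
  exists (R |: [set A; B]) => //.
  apply: (@all_alliedU1 _ _ A); rewrite ?set21 //; first exact: all_allied_pair.
  by rewrite /allied nFR nFA.
have [FRB | nFRB] := boolP (F (R :|: B)).
  exists (R |: [set A; B]) => //.
  apply: (@all_alliedU1 _ _ B); rewrite ?set22 //; first exact: all_allied_pair.
  by rewrite /allied nFR nFB.
exists [set A; B :|: R]; last first.
  apply: all_allied_pair; rewrite /allied nFA setUA [B :|: R]setUC nFRB.
  by apply: F_up FAB; apply: subsetUl.
rewrite -UE -setUA; apply: partition_pair => //.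
  by rewrite setU_eq0 (negPf B0).
exact: disjoint_setUr.
Qed.

End Allies.

(** * Secure dominating sets *)

Section SecureDomination.

Set Implicit Arguments.
Unset Strict Implicit.

Variables (T : finType) (e : rel T).
Implicit Types (A B : {set T}) (u v x : T).

Lemma dominatingS A B :
  A \subset B -> dominating e A -> dominating e B.
Proof.
move=> sAB /forallP domA; apply/forallP=> u; apply/implyP=> nBu.
have /implyP/(_ (contra (subsetP sAB u) nBu))/exists_inP[v Av euv] := domA u.
by apply/exists_inP; exists v; rewrite ?(subsetP sAB).
Qed.

Lemma secure_dominatingS A B :
  A \subset B -> secure_dominating e A -> secure_dominating e B.
Proof.
move=> sAB /andP[domA /forallP secA].
rewrite /secure_dominating (dominatingS sAB) //=.
apply/forallP=> u; apply/implyP=> nBu.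
have /implyP/(_ (contra (subsetP sAB u) nBu)) := secA u.
case/exists_inP=> v Av /andP[euv domv].
apply/exists_inP; exists v; rewrite ?(subsetP sAB) // euv.
by apply: dominatingS domv; apply: setSU; apply: setSD.
Qed.

Lemma secure_dominatingT :
  secure_dominating e [set: T].
Proof.
by apply/andP; split; apply/forallP=> u; rewrite inE.
Qed.

Lemma dominating1 v u :
  dominating e [set v] -> u != v -> e u v.
Proof.
move=> /forallP/(_ u); rewrite inE => /implyP dom /dom.
by case/exists_inP=> w /set1P->.
Qed.

(** The guard of a one-vertex secure dominating set can move to any vertex, so each
vertex alone dominates the graph. *)
Lemma small_secure_dominating A :
    0 < #|T| -> secure_dominating e A -> #|A| <= 1 ->
  forall u v, u != v -> e u v.
Proof.
move=> /card_gt0P[x0 _] secA /card_le1_eqP A1.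
have [x secx] : exists x, secure_dominating e [set x].
  have [A0 | [x Ax]] := set_0Vmem A.
    by exists x0; apply: secure_dominatingS secA; rewrite A0 sub0set.
  exists x; apply: secure_dominatingS secA; apply/subsetP=> y Ay.
  by rewrite inE; apply/eqP; apply: A1.
have /andP[domx /forallP swap] := secx.
move=> u v; apply: dominating1; have [-> // | nvx] := eqVneq v x.
have := swap v; rewrite inE nvx /= => /exists_inP[w /set1P-> /andP[_]].
by rewrite setDv set0U.
Qed.

Lemma complete_secure_dominating x :
  (forall u v, u != v -> e u v) -> secure_dominating e [set x].
Proof.
move=> comp.
have dom1 y : dominating e [set y].
  apply/forallP=> u; apply/implyP; rewrite inE => nuy.
  by apply/exists_inP; exists y; rewrite ?set11 ?comp.
rewrite /secure_dominating dom1; apply/forallP=> u; apply/implyP.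
rewrite inE => nux; apply/exists_inP; exists x; first exact: set11.
by rewrite setDv set0U dom1 comp.
Qed.

Lemma complete_degree x :
  irreflexive e -> (forall u v, u != v -> e u v) -> degree e x = #|T| - 1.
Proof.
move=> e_irr comp; rewrite /degree.
suff -> : [set u | e x u] = ~: [set x] by rewrite cardsCs setCK cards1.
apply/setP=> u; rewrite !inE; have [-> | nux] := eqVneq u x.
  exact: e_irr.
by rewrite comp // eq_sym.
Qed.

End SecureDomination.

(** * Existence of a secure coalition partition *)

Theorem theorem2p2 (T : finType) (e : rel T)
    (T_nonempty : 0 < #|T|) (e_sym : symmetric e) (e_irr : irreflexive e) :
  exists P : {set {set T}}, sec_partition e P.
Proof.
have [/forallP comp | ncomp] := boolP [forall u, forall v, (u != v) ==> e u v].
  have comp' u v : u != v -> e u v by move/forallP: (comp u) => /(_ v)/implyP.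
  exists [set [set x] | x in [set: T]]; split.
    apply/and3P; split.
    - rewrite cover_imset; apply/eqP/setP=> x; rewrite inE.
      by apply/bigcupP; exists x; rewrite ?set11.
    - apply/trivIsetP=> _ _ /imsetP[x _ ->] /imsetP[y _ ->] nxy.
      by rewrite disjoints1 inE; apply: contraNneq nxy => ->.
    - by apply/imsetP=> -[x _ /setP/(_ x)]; rewrite !inE eqxx.
  move=> _ /imsetP[x _ ->]; left; split; first exact: complete_secure_dominating.
  by exists x; split; last exact: complete_degree.
have gt1 A : secure_dominating e A -> 1 < #|A|.
  move=> secA; rewrite ltnNge; apply: contra ncomp => leA1.
  apply/forallP=> u; apply/forallP=> v; apply/implyP.
  exact: (small_secure_dominating T_nonempty secA leA1).
have FT : secure_dominating e [set: T] || ([set: T] == set0).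
  by rewrite secure_dominatingT.
have [P partP allP] := allied_partition_exists (@secure_dominatingS T e) gt1 FT.
exists P; split=> // A PA; right; have [B PB alAB] := allP A PA.
have /and3P[nA nB AB] := alAB; have nBA := allied_neq alAB.
split=> //; exists B; split=> //; rewrite /secure_coalition nA nB AB !andbT.
by move/trivIsetP: (partition_trivIset partP); apply; rewrite // eq_sym.
Qed.
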